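(* Let $l\geq 1$ and $k\geq 5$ be integers. Let $T'$ be a strong tournament on the vertices $\{1,2,\ldots,l\}$, and let $T_1,T_2,\ldots,T_l$ be regular or near regular tournaments of order $k$. Construct a tournament $T$ on $kl$ vertices as follows: let $V$ be a set of $kl$ vertices, partition $V$ into $l$ subsets $V_1,\ldots,V_l$ of size $k$, place arcs inside $V_1,\ldots,V_l$ to form copies of $T_1,T_2,\ldots,T_l$ respectively, and finally add arcs so that every vertex of $V_i$ dominates every vertex of $V_j$ if and only if $i\rightarrow j$ in $T'$. Then the resulting tournament $T$ is strongly quadrangular.
   Context: A tournament $T$ is a directed graph (no loops) such that for each pair of distinct vertices $u,v$ exactly one of $(u,v)$, $(v,u)$ is an arc; $u\rightarrow v$ ($u$ dominates $v$) means $(u,v)$ is an arc. A tournament is strong if it is strongly connected. The order of a tournament is its number of vertices. For a vertex $v$, $O(v)=\{u: v\rightarrow u\}$ and $I(v)=\{u: u\rightarrow v\}$; the out-degree of $v$ is $|O(v)|$. A tournament is regular if all vertices have the same out-degree, and near regular if the largest difference between the out-degrees of any two vertices is $1$. A digraph $D$ is strongly quadrangular if the following two conditions hold. (i) For every $S\subseteq V(D)$ such that for all $u\in S$ there exists $v\in S$, $v\neq u$, with $O(u)\cap O(v)\neq\emptyset$, one has $\left|\bigcup_{u,v\in S,\,u\neq v}(O(u)\cap O(v))\right|\geq |S|$. (ii) For every $S'\subseteq V(D)$ such that for all $u\in S'$ there exists $v\in S'$, $v\neq u$, with $I(u)\cap I(v)\neq\emptyset$, one has $\left|\bigcup_{u,v\in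 S',\,u\neq v}(I(u)\cap I(v))\right|\geq |S'|$.
   Formalization: Strong tournaments are required to have at least two vertices, which excludes l = 1; there the claim fails, e.g. for the regular tournament i → i+1, i+2 on Z/5 with S = {0,1}, whose only common out-neighbour is 2. *)

(* Defs.v *)
From mathcomp Require Import all_boot.

Set Implicit Arguments.
Unset Strict Implicit.
Unset Printing Implicit Defensive.

(* A digraph on the finite vertex type V is given by its arc relation
   e : rel V, with "e u v" for "(u, v) is an arc". *)

Section Digraph.

Variables (V : finType) (e : rel V).

Definition outset (v : V) : {set V} := [set u | e v u].
Definition inset (v : V) : {set V} := [set u | e u v].
Definition outdeg (v : V) : nat := #|outset v|.

Definition tournament : Prop :=
  irreflexive e /\ (forall u v : V, u != v -> e u v (+) e v u).

(* "connect e" is reflexive, so it makes the one-vertex digraph strongly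
   connected. Strong tournaments are taken to be nontrivial here: with a
   one-vertex quotient the composition below is a single regular or near
   regular tournament, and this need not be strongly quadrangular (in the
   rotational tournament i -> i + 1, i + 2 on Z/5, the set S = {0, 1} has a
   single common out-neighbour). *)
Definition strong : Prop :=
  1 < #|V| /\ (forall u v : V, connect e u v).

Definition regular : Prop := forall u v : V, outdeg u = outdeg v.

(* The subtraction is truncated, but the maximum ranges over ordered pairs. *)
Definition near_regular : Prop :=
  \max_(u : V) \max_(v : V) (outdeg u - outdeg v) = 1.

Definition quadrangular_cond (N : V -> {set V}) : Prop :=
  forall S : {set V},
    (forall u, u \in S ->
       exists v, [/\ v \in S, v != u & N u :&: N v != set0]) ->
    #|S| <= #|\bigcup_(u in S) \bigcup_(v in S | v != u) (N u :&: N v)|.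

Definition strongly_quadrangular : Prop :=
  quadrangular_cond outset /\ quadrangular_cond inset.

End Digraph.

(* The arcs of T inside the vertex set A form a copy of the digraph e on W. *)
Definition induces_copy (V W : finType) (T : rel V) (A : {set V})
    (e : rel W) : Prop :=
  exists f : W -> V,
    [/\ injective f, f @: [set: W] = A & forall a b, T (f a) (f b) = e a b].

(* T is obtained from the blocks P i, each of size k and together partitioning
   V, by placing a copy of Ts i inside P i and orienting all the arcs between
   two distinct blocks as in T'. *)
Definition composition (l k : nat) (T' : rel 'I_l)
    (W : 'I_l -> finType) (Ts : forall i, rel (W i))
    (V : finType) (P : 'I_l -> {set V}) (T : rel V) : Prop :=
  [/\ #|V| = k * l,
      (forall i, #|P i| = k) /\ \bigcup_i P i = [set: V],
      (forall i j, i != j -> [disjoint P i & P j]),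
      (forall i, induces_copy T (P i) (Ts i))
    & (forall i j, i != j ->
         forall u v, u \in P i -> v \in P j -> T u v = T' i j)].

(* Main.v *)
(** Let S be a set of vertices of T, C the set of vertices with at least two
    in-neighbours in S, A the set of blocks met by S, and s_i, c_i the number of
    vertices of S, C in block i.  If block j of A is dominated by another block
    of A, then every out-neighbour in block j of a vertex of S in block j lies in
    C; since out-neighbourhoods expand in a balanced tournament, c_j >= s_j.  At
    most one block a of A is dominated by no other block of A.  The missing s_a
    vertices are found by following an arc x -> y of T' that leaves A: either
    s_x >= 2 and the whole block y lies in C, or s_x = 1 and the block x
    contains more vertices of C than of S.  The condition on in-neighbourhoods
    is the same statement for the reversed tournament. *)
Require Import Defs.
From mathcomp Require Import all_boot zify.

Set Implicit Arguments.
Unset Strict Implicit.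
Unset Printing Implicit Defensive.

(** * Reversal, degrees and expansion in balanced tournaments *)

Definition reverse (V : finType) (e : rel V) : rel V := fun u v => e v u.

Lemma tournament_reverse (V : finType) (e : rel V) :
  tournament e -> tournament (reverse e).
Proof. by case=> irr tot; split=> // u v uv; rewrite addbC; exact: tot. Qed.

Lemma tournament_total (V : finType) (e : rel V) (u v : V) :
  tournament e -> u != v -> ~~ e u v -> e v u.
Proof. by case=> _ tot uv; have := tot u v uv; case: (e u v). Qed.

Lemma tournament_asym (V : finType) (e : rel V) (u v : V) :
  tournament e -> e u v -> ~~ e v u.
Proof.
case=> irr tot; case: (eqVneq u v) => [->|uv]; first by rewrite irr.
by have := tot u v uv; case: (e u v) => //=.
Qed.

(** The common weakening of regular and near regular; unlike an exact largest difference it treats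
    both at once. *)
Definition balanced (V : finType) (e : rel V) : Prop :=
  forall u v : V, outdeg e u <= outdeg e v + 1.

Lemma regular_balanced (V : finType) (e : rel V) :
  regular e \/ near_regular e -> balanced e.
Proof.
case=> [reg u v|near u v]; first by rewrite (reg u v) leq_addr.
have : outdeg e u - outdeg e v <= 1.
  rewrite -[X in _ <= X]near.
  apply: leq_trans (leq_bigmax (F := fun u => \max_v (outdeg e u - outdeg e v)) u).
  exact: (leq_bigmax (F := fun v => outdeg e u - outdeg e v)).
lia.
Qed.

Section Tournament.

Variables (V : finType) (e : rel V).
Hypothesis te : tournament e.

Lemma outdeg_reverse (v : V) : (outdeg e v + outdeg (reverse e) v).+1 = #|V|.
Proof.
have dis : outset e v :&: outset (reverse e) v = set0.
  apply/setP=> w; rewrite !inE; apply/negbTE/negP=> /andP[vw wv].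
  by move/negP: (tournament_asym te vw); apply.
rewrite /outdeg -cardsUI dis cards0 addn0 -cardsT (cardsD1 v [set: V]) inE.
congr (_.+1); apply: eq_card => w; rewrite !inE andbT.
case: (eqVneq w v) => [->|wv]; first by rewrite /reverse te.1.
case: (boolP (e v w)) => //= nvw.
by apply: (tournament_total te) nvw; rewrite eq_sym.
Qed.

Lemma balanced_reverse : balanced e -> balanced (reverse e).
Proof.
move=> be u v; have := outdeg_reverse u; have := outdeg_reverse v.
by have := be v u; lia.
Qed.

Lemma sum_outdeg_reverse :
  \sum_v outdeg e v = \sum_v outdeg (reverse e) v.
Proof.
have E (r : rel V) v : outdeg r v = \sum_w r v w.
  by rewrite /outdeg cardsE -sum1_card big_mkcond.
rewrite (eq_bigr _ (fun v _ => E e v)) exchange_big /=.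
by rewrite (eq_bigr _ (fun v _ => E (reverse e) v)).
Qed.

(** With n vertices, a vertex of out-degree at most 1 forces all others to at most 2, so the degree
    sum is below 2n. Counting arcs gives n(n-1)/2, which is at least 2n once n >= 5. *)
Lemma balanced_outdeg_ge2 (v : V) : balanced e -> 5 <= #|V| -> 2 <= outdeg e v.
Proof.
move=> be V5; rewrite leqNgt; apply/negP=> dv.
have le_sum : \sum_u outdeg e u < 2 * #|V|.
  rewrite mulnC -sum_nat_const (bigD1 v) //= [X in _ < X](bigD1 v) //=.
  rewrite -addSn leq_add //; apply: leq_sum => u _.
  by have := be u v; lia.
have : \sum_u (outdeg e u + outdeg (reverse e) u).+1 = #|V| * #|V|.
  by rewrite (eq_bigr _ (fun u _ => outdeg_reverse u)) sum_nat_const.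
have -> : \sum_u (outdeg e u + outdeg (reverse e) u).+1
    = \sum_u outdeg e u + \sum_u outdeg (reverse e) u + #|V|.
  rewrite -big_split /= -sum1_card -big_split /=.
  by apply: eq_bigr => u _; rewrite addn1.
rewrite -sum_outdeg_reverse; nia.
Qed.

(** A vertex of [X] with an in-neighbour in [X] lies in the union [N], so only a source [x] of [X]
    can be missed. It dominates the rest of [X], hence [N] contains [X :\ x] and one further vertex
    suffices. *)
Lemma balanced_expand (X : {set V}) :
  balanced e -> 5 <= #|V| -> #|X| <= #|\bigcup_(x in X) outset e x|.
Proof.
move=> be V5; set N := \bigcup_(x in X) _.
have inN x w : x \in X -> e x w -> w \in N.
  by move=> xX xw; apply/bigcupP; exists x; rewrite ?inE.
case: (boolP [exists x in X, [forall y in X, ~~ e y x]]); last first.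
  rewrite negb_exists_in => /forall_inP nosrc; apply/subset_leq_card/subsetP=> w wX.
  have := nosrc _ wX; rewrite negb_forall_in => /exists_inP[y yX].
  by rewrite negbK; exact: inN.
case/exists_inP=> x xX /forall_inP src.
have xY y : y \in X :\ x -> e x y.
  by rewrite !inE => /andP[yx yX]; apply: (tournament_total te yx); exact: src.
have YN : X :\ x \subset N.
  by apply/subsetP=> y yY; apply: inN (xY y yY).
have cX : #|X| = #|X :\ x|.+1 by rewrite (cardsD1 x X) xX.
case: (boolP (N \subset X :\ x)) => [NY|NY]; last first.
  by rewrite cX; apply: proper_card; rewrite properE YN.
(* Otherwise [X :\ x] is the out-neighbourhood of [x] and is closed under
   arcs, so balancedness makes any two of its vertices dominate each other. *)
exfalso.
have outx : outset e x = X :\ x.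
  apply/eqP; rewrite eqEsubset; apply/andP; split; apply/subsetP=> w.
    by rewrite inE => xw; apply: (subsetP NY); exact: inN xw.
  by move=> /xY; rewrite inE.
have outY y : y \in X :\ x -> outset e y = (X :\ x) :\ y.
  move=> yY; apply/eqP; rewrite eqEcard; apply/andP; split.
    apply/subsetP=> w; rewrite inE => yw; rewrite in_setD1.
    apply/andP; split.
      by apply: contraTneq yw => ->; rewrite te.1.
    by apply: (subsetP NY); apply: inN yw; move: yY; rewrite inE => /andP[].
  have := be x y; rewrite /outdeg outx (cardsD1 y (X :\ x)) yY.
  by rewrite addnC leq_add2r.
have := balanced_outdeg_ge2 x be V5; rewrite /outdeg outx.
case/card_gt1P=> y [z [yY zY yz]].
have e_yz : z \in outset e y by rewrite outY // in_setD1 eq_sym yz.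
have e_zy : y \in outset e z by rewrite outY // in_setD1 yz.
move: e_yz e_zy; rewrite !inE => /(tournament_asym te)/negP; exact.
Qed.

End Tournament.

(** * Cuts of the quotient and expansion inside the blocks *)

Definition leaves_cuts (V : finType) (e : rel V) : Prop :=
  forall (Y : {set V}) (x y : V), x \in Y -> y \notin Y ->
    exists u v, [/\ u \in Y, v \notin Y & e u v].

Lemma strong_leaves_cuts (V : finType) (e : rel V) :
  strong e -> leaves_cuts e.
Proof.
case=> _ conn Y x y; case/connectP: (conn x y) => p + ->.
elim: p x => [|z p IHp] x /=; first by move=> _ ->.
case/andP=> xz pz xY yY; case: (boolP (z \in Y)) => zY; first exact: IHp pz zY yY.
by exists x, z.
Qed.

(** A reversed arc leaves [Y] exactly when the original arc leaves the complement of [Y]. *)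
Lemma leaves_cuts_reverse (V : finType) (e : rel V) :
  leaves_cuts e -> leaves_cuts (reverse e).
Proof.
move=> cut Y x y xY yY; have [||u [v [uY vY uv]]] := cut (~: Y) y x.
- by rewrite inE.
- by rewrite inE negbK.
by exists v, u; move: uY vY; rewrite !inE negbK.
Qed.

(** Serves to let the surplus of a single block [z] pay for the deficit of the source block [a]. *)
Lemma leq_sum_pair (I : finType) (s c : I -> nat) (a z : I) :
  z != a -> s a + s z <= c a + c z ->
  (forall j, j != a -> j != z -> s j <= c j) -> \sum_i s i <= \sum_i c i.
Proof.
have split_az f : z != a ->
    \sum_i f i = f a + f z + \sum_(i | (i != a) && (i != z)) f i.
  by move=> za; rewrite (bigD1 a) //= (bigD1 z) //= addnA.
move=> za le_az le_j; rewrite !split_az //.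
by apply: leq_add => //; apply: leq_sum => j /andP[]; exact: le_j.
Qed.

(** Expansion yields c_j >= s_j in a dominated block. The out-degree bound yields c_j >= 2 there,
    and the in-degree bound puts a block contained in [S] inside [C]. *)
Definition block_expanding (V : finType) (T : rel V) (A : {set V}) : Prop :=
  (forall X : {set V}, X \subset A ->
     #|X| <= #|(\bigcup_(x in X) outset T x) :&: A|) /\
  (forall u, u \in A ->
     2 <= #|outset T u :&: A| /\ 2 <= #|outset (reverse T) u :&: A|).

Lemma induces_copy_reverse (V W : finType) (T : rel V) (A : {set V}) (e : rel W) :
  induces_copy T A e -> induces_copy (reverse T) A (reverse e).
Proof. by case=> f [f_inj fA Tf]; exists f; split=> // a b; exact: Tf. Qed.

Lemma copy_outset (V W : finType) (T : rel V) (A : {set V}) (e : rel W)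
    (f : W -> V) (a : W) :
  f @: [set: W] = A -> (forall a b, T (f a) (f b) = e a b) ->
  f @: outset e a \subset outset T (f a) :&: A.
Proof.
move=> fA Tf; apply/subsetP=> _ /imsetP[b + ->]; rewrite !inE => ab.
by rewrite Tf ab -fA imset_f.
Qed.

Lemma copy_block_expanding (V W : finType) (T : rel V) (A : {set V}) (e : rel W) :
  tournament e -> balanced e -> 5 <= #|W| -> induces_copy T A e ->
  block_expanding T A.
Proof.
move=> te be W5 [f [f_inj fA Tf]]; split=> [X XA|u].
  have defX : X = f @: (f @^-1: X).
    apply/setP=> x; apply/idP/imsetP=> [xX|[a + ->]]; last by rewrite inE.
    have := subsetP XA x xX; rewrite -fA => /imsetP[a _ xa].
    by exists a; rewrite // inE -xa.
  rewrite {1}defX card_imset //.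
  apply: leq_trans (balanced_expand te (f @^-1: X) be W5) _.
  rewrite -(card_imset _ f_inj); apply: subset_leq_card; apply/subsetP=> _ /imsetP[b + ->].
  case/bigcupP=> a; rewrite inE => aX ab.
  have := subsetP (copy_outset a fA Tf) (f b) (imset_f f ab).
  rewrite !in_setI => /andP[fab ->]; rewrite andbT.
  by apply/bigcupP; exists (f a).
rewrite -fA => /imsetP[a _ ->]; rewrite fA; split.
  apply: leq_trans (balanced_outdeg_ge2 te a be W5) _.
  by rewrite /outdeg -(card_imset _ f_inj) subset_leq_card // copy_outset.
apply: leq_trans (balanced_outdeg_ge2 (tournament_reverse te) a (balanced_reverse te be) W5) _.
rewrite /outdeg -(card_imset _ f_inj) subset_leq_card // copy_outset // => b c.
exact: Tf.
Qed.

(** * Counting common out-neighbours block by block *)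

Section Blocks.

Variables (l k : nat) (T' : rel 'I_l) (V : finType) (P : 'I_l -> {set V}).
Variable T : rel V.
Hypothesis k_gt1 : 1 < k.
Hypothesis tT' : tournament T'.
Hypothesis cutT' : leaves_cuts T'.
Hypothesis l_gt1 : 1 < l.
Hypothesis cardP : forall i, #|P i| = k.
Hypothesis coverP : \bigcup_i P i = [set: V].
Hypothesis disjP : forall i j, i != j -> [disjoint P i & P j].
Hypothesis expP : forall i, block_expanding T (P i).
Hypothesis arcP : forall i j, i != j ->
  forall u v, u \in P i -> v \in P j -> T u v = T' i j.

Lemma mem_block (v : V) : exists i, v \in P i.
Proof.
have /bigcupP[i _ vP] : v \in \bigcup_i P i by rewrite coverP inE.
by exists i.
Qed.

Lemma card_blocks (S : {set V}) : #|S| = \sum_i #|S :&: P i|.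
Proof.
have {1}-> : S = \bigcup_i (S :&: P i) by rewrite -big_distrr /= coverP setIT.
rewrite -sum1_card partition_disjoint_bigcup => [|i j ij].
  by apply: eq_bigr => i _; rewrite sum1_card.
by apply: disjointWl (subsetIr _ _) _; apply: disjointWr (subsetIr _ _) (disjP ij).
Qed.

Lemma blocks_distinct (i j : 'I_l) (u v : V) :
  i != j -> u \in P i -> v \in P j -> u != v.
Proof.
move=> ij uPi vPj; apply: contraTneq vPj => <-.
by have /disjointFr-> := disjP ij.
Qed.

Lemma quadrangular_blocks : quadrangular_cond (outset T).
Proof.
move=> S partner; set C := \bigcup_(u in S) _.
have inC u v w : u \in S -> v \in S -> u != v -> T u w -> T v w -> w \in C.
  move=> uS vS uv uw vw; apply/bigcupP; exists u => //.
  by apply/bigcupP; exists v; rewrite ?inE ?uw ?vw // vS eq_sym.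
pose s i := #|S :&: P i|; pose c i := #|C :&: P i|.
have s_le i : s i <= k by rewrite -(cardP i) subset_leq_card ?subsetIr.
have c_full i : P i \subset C -> c i = k by move/setIidPr; rewrite /c => ->.
have irrT' i j : T' i j -> i != j.
  by apply: contraTneq => ->; rewrite tT'.1.
have full i j : T' i j -> 2 <= s i -> c j = k.
  move=> ij /card_gt1P[u [v []]]; rewrite !inE => /andP[uS uP] /andP[vS vP] uv.
  apply: c_full; apply/subsetP=> w wP.
  by apply: (inC u v) => //; rewrite (arcP (irrT' _ _ ij)).
(* Of the two in-neighbours of [w], one lies in block [i] and the other in block [j] itself. *)
have dominated i j : T' i j -> 0 < s i ->
    (\bigcup_(x in S :&: P j) outset T x) :&: P j \subset C :&: P j.
  move=> ij; rewrite card_gt0 => /set0Pn[u]; rewrite inE => /andP[uS uP].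
  apply/subsetP=> w; rewrite in_setI => /andP[/bigcupP[v]].
  rewrite !in_setI inE => /andP[vS vP] vw wP; rewrite wP andbT.
  apply: (inC u v) => //; first exact: blocks_distinct (irrT' _ _ ij) uP vP.
  by rewrite (arcP (irrT' _ _ ij) uP wP).
have c_ge i j : T' i j -> 0 < s i -> s j <= c j.
  move=> ij si; apply: leq_trans (subset_leq_card (dominated i j ij si)).
  by apply: (expP j).1; exact: subsetIr.
have c_ge2 i j : T' i j -> 0 < s i -> 0 < s j -> 2 <= c j.
  move=> ij si; rewrite card_gt0 => /set0Pn[u uSP].
  have uP : u \in P j by move: uSP; rewrite inE => /andP[].
  apply: leq_trans (subset_leq_card (dominated i j ij si)).
  apply: leq_trans ((expP j).2 u uP).1 _; apply: subset_leq_card.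
  by apply: setSI; apply: bigcup_sup.
have c_all i : s i = k -> c i = k.
  move=> sik; have PS : P i \subset S.
    by apply/setIidPr/eqP; rewrite eqEcard subsetIr cardP -sik leqnn.
  apply: c_full; apply/subsetP=> w wP.
  have /card_gt1P[u [v []]] := ((expP i).2 w wP).2.
  rewrite !inE => /andP[uw uP] /andP[vw vP] uv.
  by apply: (inC u v) => //; exact: (subsetP PS).
rewrite (card_blocks S) (card_blocks C).
case: (boolP [exists a, (0 < s a) && [forall i, (0 < s i) ==> ~~ T' i a]]); last first.
  rewrite negb_exists => /forallP nosrc; apply: leq_sum => j _.
  case: (posnP (s j)) => [sj|sj]; first by rewrite -/(s j) sj.
  have := nosrc j; rewrite sj negb_forall => /existsP[i].
  by rewrite negb_imply negbK => /andP[si ij]; exact: c_ge ij si.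
case/existsP=> a /andP[sa /forallP src].
have s0 j : ~~ (0 < s j) -> s j = 0 by rewrite -eqn0Ngt => /eqP.
have a_dom j : 0 < s j -> j != a -> T' a j.
  by move=> sj ja; apply: (tournament_total tT' ja); have := src j; rewrite sj.
have rest j : j != a -> s j <= c j.
  move=> ja; case: (boolP (0 < s j)) => [sj|/s0->//].
  exact: c_ge (a_dom j sj ja) sa.
pose B := [set j | (0 < s j) && (j != a)].
(* If [B] is empty, [S] lies in block [a]; the hypothesis on partners then gives s_a >= 2, and an
   arc of [T'] leaving [a] leads to a full block. *)
case: (set_0Vmem B) => [B0|[j jB]].
  have sS j : j != a -> s j = 0.
    by move=> ja; apply: s0; move/setP/(_ j): B0; rewrite !inE ja andbT => ->.
  have SP v : v \in S -> v \in P a.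
    move=> vS; have [i vP] := mem_block v.
    case: (eqVneq i a) => [<- //|/sS/eqP]; rewrite cards_eq0 => /eqP/setP/(_ v).
    by rewrite !inE vS vP.
  have sa2 : 2 <= s a.
    move: (sa); rewrite card_gt0 => /set0Pn[u]; rewrite inE => /andP[uS uP].
    have [v [vS vu _]] := partner u uS.
    by apply/card_gt1P; exists u, v; rewrite !inE uS uP vS SP // eq_sym.
  have [b ba] : exists b, b != a.
    have : 1 < #|[set: 'I_l]| by rewrite cardsT card_ord.
    by rewrite (cardsD1 a) inE => /card_gt0P[b]; rewrite !inE andbT; exists b.
  have [||x [y []]] := cutT' (Y := [set a]) (x := a) (y := b); rewrite ?inE //.
  move=> /eqP-> ya ay.
  apply: (leq_sum_pair ya) => [|i ia _]; last exact: rest.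
  rewrite -/(s a) -/(s y) -/(c a) -/(c y) (sS y ya) (full _ _ ay sa2).
  by have := s_le a; lia.
(* Cutting at [B], without [a], makes the arc start at some [x] dominated by [a]. It cannot end at
   the source [a], so block [y] misses [S]. *)
have [||x [y []]] := cutT' (Y := B) (x := j) (y := a) => //.
  by rewrite !inE eqxx andbF.
rewrite !inE => /andP[sx xa] yB xy.
have ya : y != a by apply: contraTneq xy => ->; have := src x; rewrite sx.
have sy : s y = 0 by apply: s0; move: yB; rewrite ya andbT.
have ax := a_dom x sx xa.
case: (leqP 2 (s x)) => sx2.
  apply: (leq_sum_pair ya) => [|i ia _]; last exact: rest.
  rewrite -/(s a) -/(s y) -/(c a) -/(c y) sy (full _ _ xy sx2).
  by have := s_le a; lia.
apply: (leq_sum_pair xa) => [|i ia _]; last exact: rest.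
rewrite -/(s a) -/(s x) -/(c a) -/(c x).
(* Here s_x = 1. If s_a >= 2 then c_x = k, which suffices for s_a < k; for s_a = k also c_a = k. If
   s_a = 1, then c_x >= 2 suffices. *)
case: (leqP 2 (s a)) => sa2.
  rewrite (full _ _ ax sa2); have := s_le a; rewrite leq_eqVlt.
  by case/orP=> [/eqP/[dup]/c_all-> ->|]; lia.
by have := c_ge2 _ _ ax sa sx; lia.
Qed.

End Blocks.

Theorem theorem3p1 (l k : nat) (hl : 1 <= l) (hk : 5 <= k)
    (T' : rel 'I_l) (hT' : tournament T') (sT' : strong T')
    (W : 'I_l -> finType) (Ts : forall i : 'I_l, rel (W i))
    (hTs : forall i : 'I_l, tournament (Ts i))
    (oTs : forall i : 'I_l, #|W i| = k)
    (rTs : forall i : 'I_l, regular (Ts i) \/ near_regular (Ts i))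
    (V : finType) (P : 'I_l -> {set V}) (T : rel V)
    (hT : composition k T' Ts P T) :
  tournament T /\ strongly_quadrangular T.
Proof.
case: hT => _ [cardP coverP] disjP copyP arcP.
have k_gt1 : 1 < k by apply: leq_trans hk.
have l_gt1 : 1 < l by have := sT'.1; rewrite card_ord.
have balTs i : balanced (Ts i) by exact: regular_balanced.
have W5 i : 5 <= #|W i| by rewrite oTs.
have cutT' := strong_leaves_cuts sT'.
split; last split.
- split=> [u|u v uv].
    have [i] := mem_block coverP u; have [f [_ <- Tf]] := copyP i.
    by case/imsetP=> a _ ->; rewrite Tf (hTs i).1.
  have [i uP] := mem_block coverP u; have [j vP] := mem_block coverP v.
  case: (eqVneq i j) => [ij|ij]; last first.
    by rewrite (arcP i j) // (arcP j i) 1?eq_sym //; exact: hT'.2.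
  move: uP vP uv; rewrite -ij; have [f [_ <- Tf]] := copyP i.
  case/imsetP=> a _ -> /imsetP[b _ ->] ab; rewrite !Tf; apply: (hTs i).2.
  by apply: contraNneq ab => ->.
- apply: (quadrangular_blocks k_gt1 hT' cutT' l_gt1 cardP coverP disjP _ arcP) => i.
  exact: copy_block_expanding (copyP i).
(* [inset T] and [outset (reverse T)] agree by computation, and every hypothesis on the quotient and
   the blocks survives reversal. *)
- apply: (quadrangular_blocks k_gt1 (tournament_reverse hT')
    (leaves_cuts_reverse cutT') l_gt1 cardP coverP disjP (T := reverse T)) => [i|i j ij u v uP vP].
    exact: (copy_block_expanding (tournament_reverse (hTs i))
      (balanced_reverse (hTs i) (balTs i)) (W5 i) (induces_copy_reverse (copyP i))).
  by apply: arcP => //; rewrite eq_sym.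
Qed.
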